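(* Let $d,l\ge 1$ be integers, let $n_1,\dots,n_d$ be positive integers, and let $M\subset\mathcal{P}([d])$ be non-empty. If $A\subset[n_1]\times\dots\times[n_d]$ satisfies $\mathrm{c}_M(A)=l$, then there are at most $(|M|\,l^d)^l$ $l$-tuples $(S_1,\dots,S_l)$ such that each $S_i$ is an $M$-subspace and $A\subset S_1\cup\dots\cup S_l$.
   Context: $[k]=\{1,\dots,k\}$. For $B \subset [d]$, a $B$-subspace is a maximal subset $S$ of $[n_1]\times\dots\times[n_d]$ such that $x_i = y_i$ whenever $x,y\in S$ and $i \notin B$. For non-empty $M\subset\mathcal{P}([d])$, an $M$-subspace is a $B$-subspace for some $B\in M$. The $M$-covering number $\mathrm{c}_M(A)$ of $A\subset[n_1]\times\dots\times[n_d]$ is the smallest nonnegative integer $k$ such that $A$ is contained in a union of $k$ $M$-subspaces. *)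

(* Defs.v *)
From mathcomp Require Import all_boot.

Set Implicit Arguments.
Unset Strict Implicit.
Unset Printing Implicit Defensive.

(* The factor [k] = {1, .., k} is represented by 'I_k = {0, .., k-1}, and the
   coordinates 1, .., d by 'I_d. *)
Definition grid (d : nat) (n : 'I_d -> nat) : finType :=
  {dffun forall i : 'I_d, 'I_(n i)}.

Section Subspaces.

Variables (d : nat) (n : 'I_d -> nat).
Implicit Types (B : {set 'I_d}) (M : {set {set 'I_d}}) (S A : {set grid n}).

Definition agree_off B S : bool :=
  [forall x in S, forall y in S, forall i : 'I_d, (i \notin B) ==> (x i == y i)].

Definition is_subspace B S : bool := maxset (agree_off B) S.

Definition is_Msubspace M S : bool := [exists B in M, is_subspace B S].

Definition is_Mcover M A (k : nat) (s : k.-tuple {set grid n}) : bool :=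
  [forall i : 'I_k, is_Msubspace M (tnth s i)]
    && (A \subset \bigcup_(i < k) tnth s i).

Definition Mcoverable M A (k : nat) : bool :=
  [exists s : k.-tuple {set grid n}, is_Mcover M A s].

Lemma Mcoverable_ex M A : M != set0 -> exists k, Mcoverable M A k.
Proof.
case/set0Pn=> B BM; exists #|grid n|; apply/existsP.
have ex x : exists S, is_subspace B S && (x \in S).
  have agr : agree_off B [set x].
    apply/forall_inP=> y /set1P->; apply/forall_inP=> z /set1P->.
    by apply/forallP=> i; rewrite eqxx implybT.
  have [S maxS] := maxset_exists agr; rewrite sub1set => xS.
  by exists S; rewrite /is_subspace maxS.
pose f x := xchoose (ex x).
have fP x : is_subspace B (f x) && (x \in f x) := xchooseP (ex x).
exists [tuple f (enum_val i) | i < #|grid n|]; apply/andP; split.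
  apply/forallP=> i; rewrite tnth_mktuple; apply/exists_inP.
  by exists B => //; case/andP: (fP (enum_val i)).
apply/subsetP=> x _; apply/bigcupP; exists (enum_rank x) => //.
by rewrite tnth_mktuple enum_rankK; case/andP: (fP x).
Qed.

(* Non-emptiness of M is what makes the minimum range over a non-empty set. *)
Definition covering_number M (M_neq0 : M != set0) A : nat :=
  ex_minn (Mcoverable_ex A M_neq0).

End Subspaces.

(* Main.v *)
Require Import Defs.
From mathcomp Require Import all_boot.

Set Implicit Arguments.
Unset Strict Implicit.
Unset Printing Implicit Defensive.

(** Fix the members of a minimum cover one at a time. While fewer than [k] of
    the [k] members are fixed, minimality leaves a point [a] of [A] uncovered
    by them, so one of the remaining members must contain [a]. If each point of
    [A] lies in at most [D] sets of the family, [m] remaining members thus leave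
    at most [m * D] ways to fix one more, hence at most [k`! * D ^ k] covers.
    Through each point of the grid there is exactly one [B]-subspace for each
    [B] in [M], so [D = #|M|] works for [M]-subspaces. *)

Lemma ffact_leq_expn n m : n ^_ m <= n ^ m.
Proof. by elim: m => // m IHm; rewrite ffactnSr expnSr leq_mul ?leq_subr. Qed.

Lemma card_bigcup_leq (I T : finType) (P : {set I}) (F : I -> {set T}) m :
  (forall i, i \in P -> #|F i| <= m) -> #|\bigcup_(i in P) F i| <= #|P| * m.
Proof.
move=> leFm; rewrite -cover_imset.
apply: leq_trans (leq_card_cover _) _.
apply: (@leq_trans (#|F @: P| * m)); last first.
  by rewrite leq_mul // leq_imset_card.
by rewrite -sum_nat_const; apply: leq_sum => _ /imsetP[i iP ->]; apply: leFm.
Qed.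

Section MinimumCovers.

Variables (T : finType) (F : {set {set T}}) (A : {set T}).

Definition is_cover (s : seq {set T}) : bool :=
  all [in F] s && (A \subset \bigcup_(S <- s) S).

Definition sets_containing (a : T) : {set {set T}} := [set S in F | a \in S].

Definition agree_on k (J : {set 'I_k}) (s t : k.-tuple {set T}) : bool :=
  [forall j in J, tnth s j == tnth t j].

Lemma agree_onP k (J : {set 'I_k}) (s t : k.-tuple {set T}) :
  reflect {in J, tnth s =1 tnth t} (agree_on J s t).
Proof. by apply: (iffP forall_inP) => st j jJ; apply/eqP/st. Qed.

Definition covers_extending k (J : {set 'I_k}) (s : k.-tuple {set T}) :
    {set k.-tuple {set T}} :=
  [set t : k.-tuple {set T} | is_cover t & agree_on J s t].

Variables (D k : nat).
Implicit Types (J : {set 'I_k}) (s t u : k.-tuple {set T}).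
Hypothesis degree_leq : forall a, a \in A -> #|sets_containing a| <= D.
Hypothesis cover_size_geq : forall s : seq {set T}, is_cover s -> k <= size s.

Lemma exists_uncovered_point J s :
  is_cover s -> #|J| < k ->
  exists2 a, a \in A & a \notin \bigcup_(j in J) tnth s j.
Proof.
case/andP=> /all_tnthP sF _ ltJk; apply/subsetPn.
apply: contraL ltJk => subA; rewrite -leqNgt -(size_image (tnth s)).
apply: cover_size_geq; rewrite /is_cover big_image subA andbT.
by apply/allP=> _ /imageP[j _ ->].
Qed.

Lemma covers_extending_sub_bigcup J s a :
  a \in A -> a \notin \bigcup_(j in J) tnth s j ->
  covers_extending J s \subset
    \bigcup_(p in setX (~: J) (sets_containing a))
      [set t in covers_extending J s | tnth t p.1 == p.2].
Proof.
move=> aA aNs; apply/subsetP=> t tJ.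
have /[!inE]/andP[/andP[/all_tnthP tF /subsetP/(_ a aA)]] := tJ.
rewrite big_tuple => /bigcupP[j _ atj] /agree_onP st.
apply/bigcupP; exists (j, tnth t j); last by rewrite inE tJ /=.
rewrite !inE /= tF atj !andbT.
by apply: contra aNs => jJ; apply/bigcupP; exists j; rewrite ?st.
Qed.

Lemma covers_extending_sub_setU1 J s u j :
  u \in covers_extending J s ->
  [set t in covers_extending J s | tnth t j == tnth u j] \subset
    covers_extending (j |: J) u.
Proof.
rewrite inE => /andP[_ /agree_onP su]; apply/subsetP=> t.
rewrite !inE => /andP[/andP[-> /agree_onP st] /eqP tuj].
by apply/agree_onP=> i /setU1P[-> | iJ]; rewrite ?tuj // -su ?st.
Qed.

Lemma card_covers_extending_leq J s :
  is_cover s -> #|covers_extending J s| <= #|~: J|`! * D ^ #|~: J|.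
Proof.
move cardJC: #|~: J| => m; elim: m => [|m IHm] in J s cardJC *.
  move/cards0_eq: cardJC => JC0 _; rewrite fact0 expn0 muln1 -(cards1 s).
  apply/subset_leq_card/subsetP=> t; rewrite !inE => /andP[_ /agree_onP st].
  by apply/eqP/eq_from_tnth=> j; rewrite st // -[J]setCK JC0 setC0.
move=> cov_s.
have [|a aA aNs] := exists_uncovered_point (J := J) cov_s.
  by rewrite -[ltnRHS]card_ord -(cardsC J) cardJC -addSnnS leq_addr.
apply: leq_trans (subset_leq_card (covers_extending_sub_bigcup aA aNs)) _.
apply: (@leq_trans (#|setX (~: J) (sets_containing a)| * (m`! * D ^ m))).
  apply: card_bigcup_leq => -[j S] /setXP[/= jNJ _].
  set E := [set _ in _ | _]; have [-> | [u]] := set_0Vmem E.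
    by rewrite cards0.
  rewrite inE => /andP[uJ /eqP tnth_uj].
  have cov_u : is_cover u by move: uJ; rewrite inE => /andP[].
  apply: leq_trans (IHm (j |: J) u _ cov_u).
    by rewrite /E -tnth_uj; apply/subset_leq_card/covers_extending_sub_setU1.
  move: cardJC; rewrite (cardsD1 j) jNJ => -[<-].
  by rewrite setCU setIC -setDE.
by rewrite cardsX cardJC factS expnS mulnACA !leq_mul ?degree_leq.
Qed.

Lemma card_minimum_covers_leq :
  #|[set s : k.-tuple {set T} | is_cover s]| <= k`! * D ^ k.
Proof.
set C := [set _ | _]; have [-> | [s]] := set_0Vmem C.
  by rewrite cards0.
rewrite inE => /(card_covers_extending_leq set0); rewrite setC0 cardsT card_ord.
apply: leq_trans; apply/subset_leq_card/subsetP=> t.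
by rewrite !inE => ->; apply/agree_onP=> j; rewrite inE.
Qed.

End MinimumCovers.

Section Subspaces.

Variables (d : nat) (n : 'I_d -> nat).
Implicit Types (B : {set 'I_d}) (M : {set {set 'I_d}}) (S A : {set grid n}).
Implicit Types (a x y : grid n).

Lemma agree_offP B S :
  reflect {in S &, forall x y i, i \notin B -> x i = y i} (agree_off B S).
Proof.
apply: (iffP forall_inP) => [agrS x y xS yS i iNB | agrS x xS].
  by have /forall_inP/(_ y yS)/forall_inP/(_ i iNB)/eqP := agrS x xS.
apply/forall_inP=> y yS; apply/forall_inP=> i iNB.
by apply/eqP/agrS.
Qed.

Definition subspace_through B a : {set grid n} :=
  [set x : grid n | [forall (i | i \notin B), x i == a i]].

Lemma subspace_throughP B a x :
  reflect (forall i, i \notin B -> x i = a i) (x \in subspace_through B a).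
Proof.
by rewrite inE; apply: (iffP forall_inP) => xa i iNB; apply/eqP/xa.
Qed.

Lemma agree_off_through B a : agree_off B (subspace_through B a).
Proof.
apply/agree_offP=> x y /subspace_throughP xa /subspace_throughP ya i iNB.
by rewrite xa ?ya.
Qed.

Lemma is_subspace_eq_through B S a :
  is_subspace B S -> a \in S -> S = subspace_through B a.
Proof.
case/maxsetP=> /agree_offP agrS maxS aS; apply/esym/maxS.
  exact: agree_off_through.
by apply/subsetP=> x xS; apply/subspace_throughP/agrS.
Qed.

Definition Msubspaces M : {set {set grid n}} := [set S | is_Msubspace M S].

Lemma card_Msubspaces_containing_leq M a :
  #|sets_containing (Msubspaces M) a| <= #|M|.
Proof.
apply: leq_trans (leq_imset_card (subspace_through^~ a) M).
apply/subset_leq_card/subsetP=> S.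
rewrite 2!inE => /andP[/exists_inP[B BM subS] aS].
by apply/imsetP; exists B => //; apply: is_subspace_eq_through.
Qed.

Lemma is_McoverE M A k (s : k.-tuple {set grid n}) :
  is_Mcover M A s = is_cover (Msubspaces M) A s.
Proof.
rewrite /is_cover big_tuple; congr (_ && _).
by apply/forallP/all_tnthP=> sM i; move: (sM i); rewrite inE.
Qed.

Lemma covering_number_leq_size M (M_neq0 : M != set0) A s :
  is_cover (Msubspaces M) A s -> covering_number M_neq0 A <= size s.
Proof.
move=> cov_s; rewrite /covering_number; case: ex_minnP => k _; apply.
by apply/existsP; exists (in_tuple s); rewrite is_McoverE.
Qed.

End Subspaces.

Theorem theorem2p5 (d l : nat) (d_gt0 : 0 < d) (l_gt0 : 0 < l)
    (n : 'I_d -> nat) (n_gt0 : forall i : 'I_d, 0 < n i)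
    (M : {set {set 'I_d}}) (M_neq0 : M != set0)
    (A : {set grid n}) (cA : covering_number M_neq0 A = l) :
  #|[set s : l.-tuple {set grid n} | is_Mcover M A s]| <= (#|M| * l ^ d) ^ l.
Proof.
under eq_finset do rewrite is_McoverE.
apply: leq_trans (card_minimum_covers_leq (D := #|M|) _ _) _.
- by move=> a _; apply: card_Msubspaces_containing_leq.
- by move=> s; rewrite -cA; apply: covering_number_leq_size.
rewrite mulnC expnMn leq_mul2l; apply/orP; right.
rewrite -ffactnn; apply: leq_trans (ffact_leq_expn _ _) _.
by rewrite leq_exp2r // -[leqLHS]expn1 leq_pexp2l.
Qed.
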